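(* Suppose that $N$ is a non-negative integer-valued random variable defined on some probability space $(\Omega,\mathcal{F},\mathbb{P})$ with $\mathbb{P}(N=0)<1$, and, on the same space, $X_1,X_2,\ldots$ is a sequence of i.i.d. random variables, independent of $N$. Suppose that $S_N:=\sum_{i=1}^N X_i$ is Poisson distributed. (a) If $X_1\sim\mathrm{Bernoulli}(p)$ for some $p\in(0,1)$, then $N\sim\mathrm{Poisson}(\lambda)$ for some $\lambda>0$. (b) If $N\sim\mathrm{Poisson}(\lambda)$ for some $\lambda>0$, then $X_1\sim\mathrm{Bernoulli}(p)$ for some $p\in(0,1)$.
   Context: ''The sequence is independent of $N$'' means that $N$ is independent of the whole sequence $(X_i)_{i\ge1}$. An empty sum is $0$. $\mathrm{Bernoulli}(p)$ is the law with mass $p$ at $1$ and $1-p$ at $0$. $\mathrm{Poisson}(\lambda)$ is the law on the non-negative integers with mass $e^{-\lambda}\lambda^k/k!$ at $k$.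
   Formalization: In (b) the formal conclusion is p in (0,1] instead of (0,1), since X_i = 1 for all i with N Poisson gives S_N = N, where only p = 1 is possible; ''Poisson distributed'' for S_N is read with a positive parameter. *)

(* Defs.v *)
From HB Require Import structures.
From mathcomp Require Import all_boot all_order all_algebra finmap.
From mathcomp Require Import all_classical all_reals all_analysis.

Set Implicit Arguments.
Unset Strict Implicit.
Unset Printing Implicit Defensive.

Import Order.TTheory GRing.Theory Num.Theory.
Import numFieldNormedType.Exports.

Local Open Scope classical_set_scope.
Local Open Scope ring_scope.

(* The equality of laws is required on measurable sets only: a measure is a
   function on all subsets, with arbitrary values on nonmeasurable ones. *)
Definition has_law d d' (T : measurableType d) (T' : measurableType d')
    (R : realType) (P : probability T R) (Y : {RV P >-> T'})
    (mu : set T' -> \bar R) : Prop :=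
  forall A : set T', measurable A -> distribution P Y A = mu A.

(* The second argument of [poisson_prob] is a dummy. *)
Definition poisson_nat (R : realType) (l : R) : set nat -> \bar R :=
  poisson_prob l 0%N.

Definition poisson_real (R : realType) (l : R) : set R -> \bar R :=
  pushforward (poisson_nat l) (fun k : nat => k%:R : R).

Definition bernoulli_real (R : realType) (p : R) : set R -> \bar R :=
  pushforward (bernoulli_prob p) (fun b : bool => b%:R : R).

Section independence.
Context d (T : measurableType d) (R : realType) (P : probability T R).

Definition mutually_independent (I : choiceType) d' (T' : measurableType d')
    (X : I -> {RV P >-> T'}) : Prop :=
  forall (J : {fset I}) (A : I -> set T'), (forall i, measurable (A i)) ->
    P (\bigcap_(i in [set` J]) (X i @^-1` A i)) =
    (\prod_(i <- J) P (X i @^-1` A i))%E.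

Definition identically_distributed (I : Type) d' (T' : measurableType d')
    (X : I -> {RV P >-> T'}) : Prop :=
  forall i j, has_law (X i) (distribution P (X j)).

Definition iid (I : choiceType) d' (T' : measurableType d')
    (X : I -> {RV P >-> T'}) : Prop :=
  mutually_independent X /\ identically_distributed X.

Definition sigma_family (I : Type) d' (T' : measurableType d')
    (X : I -> {RV P >-> T'}) : set (set T) :=
  <<s \bigcup_i preimage_set_system setT (X i) measurable >>.

Definition independent_of_family (I : Type) d1 d2 (T1 : measurableType d1)
    (T2 : measurableType d2) (Y : {RV P >-> T1}) (X : I -> {RV P >-> T2}) :
    Prop :=
  forall (B : set T1) (E : set T), measurable B -> sigma_family X E ->
    P (Y @^-1` B `&` E) = (P (Y @^-1` B) * P E)%E.

(* The sequence is indexed from 0: [X i] stands for $X_{i+1}$. *)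
Definition random_sum (N : {RV P >-> nat}) (X : nat -> {RV P >-> R}) (w : T)
    : R :=
  \sum_(i < N w) X i w.

Lemma measurable_random_sum (N : {RV P >-> nat}) (X : nat -> {RV P >-> R}) :
  measurable_fun setT (random_sum N X).
Proof.
move=> _ B mB; rewrite setTI.
rewrite (_ : _ @^-1` B = \bigcup_n (N @^-1` [set n] `&`
    (fun w => \sum_(i < n) X i w) @^-1` B)); last first.
  apply/seteqP; split => [w /= Bw|w [n _ [/= Nw]]]; first by exists (N w).
  by rewrite /random_sum Nw.
apply: bigcup_measurable => n _; apply: measurableI.
  exact: measurable_funPTI.
by rewrite -[X in measurable X]setTI; apply: measurable_sum.
Qed.

HB.instance Definition _ (N : {RV P >-> nat}) (X : nat -> {RV P >-> R}) :=
  isMeasurableFun.Build _ _ _ _ (random_sum N X) (measurable_random_sum N X).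

End independence.

(* Main.v *)
Require Import Defs.
From HB Require Import structures.
From mathcomp Require Import all_boot all_order all_algebra finmap.
From mathcomp Require Import all_classical all_reals all_analysis.
From mathcomp Require Import ring.

Set Implicit Arguments.
Unset Strict Implicit.
Unset Printing Implicit Defensive.

Import Order.TTheory GRing.Theory Num.Theory.
Import numFieldNormedType.Exports.

Local Open Scope classical_set_scope.
Local Open Scope ring_scope.

(** Given [N = n], the sum counts successes: if every [X i] is almost surely
    natural-valued with mass [x0] at 0 and [x1] at 1, and if no value in
    2, ..., k has positive mass, then only the terms equal to 0 or 1 can enter a
    total of k, so that a sum of n terms equals k with probability
    C(n, k) x1^k x0^(n-k) (lemma [partial_sum_law]).  Averaging over [N],
    which is independent of the [X i],
      P(S = k) = sum_n P(N = n) C(n, k) x1^k x0^(n-k),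
    that is, the law of [N] is thinned.  Thinning a Poisson law is explicit
    ([poisson_thinning]):
      sum_n e^(-l) l^n / n! C(n, k) x^k y^(n-k) = (l x)^k / k! e^(l (y - 1)).

    If [X 0] is Bernoulli(p), the law of [N] and Poisson(mu / p) are therefore
    both thinned to Poisson(mu), and it is enough that thinning is injective.
    The thinning kernel has the kernel with parameters 1/p, -(1-p)/p as its
    inverse, because w |-> (w - q) / p inverts z |-> q + p z on generating
    functions.  This inverse has alternating signs, so summing it termwise needs
    absolute convergence.  The positive and the negative terms are summed
    separately: both sums are finite, as they are dominated by a thinning of a
    Poisson law with positive parameters ([thinning_injective]).

    If [N] is Poisson(l), then [X 0] is natural-valued because [S] is, the event
    [N = 1] having positive probability.  Only the values k = 0, 1 are then
    needed, and for these the condition on the masses at 2, ..., k is vacuous: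
      e^(l (x0 - 1)) = e^(-mu)   and   l x1 e^(l (x0 - 1)) = mu e^(-mu),
    whence l x1 = mu = l (1 - x0).  Thus x0 + x1 = 1, and [X 0] is
    Bernoulli(mu / l). *)

(** * Binomial thinning *)

(** For [y = 1 - x] this is the probability that k points out of n survive when
    each is kept with probability [x].  The parameters are left free because the
    inverse kernel has a negative second parameter. *)
Definition thinning (R : pzRingType) (x y : R) (n k : nat) : R :=
  'C(n, k)%:R * x ^+ k * y ^+ (n - k).

Section thinning_algebra.
Variable R : fieldType.
Implicit Types x y : R.

Lemma thinning_small x y n k : (n < k)%N -> thinning x y n k = 0.
Proof. by move=> nk; rewrite /thinning bin_small// !mul0r. Qed.

Lemma thinningS0 x y n : thinning x y n.+1 0 = thinning x y n 0 * y.
Proof. by rewrite /thinning !bin0 !subn0 exprSr; ring. Qed.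

Lemma thinningSS x y n k :
  thinning x y n.+1 k.+1 = thinning x y n k.+1 * y + thinning x y n k * x.
Proof.
rewrite /thinning binS subSS natrD !mulrDl exprS; congr (_ + _); last by ring.
case: (ltnP n k.+1) => [nk|kn]; first by rewrite bin_small// !mul0r.
by rewrite -(@prednK (n - k)) ?subn_gt0// -subnS [in LHS]exprSr; ring.
Qed.

(** The row of index n lists the coefficients of the n-th power of an affine
    polynomial, so that products of kernels become compositions of affine
    maps. *)
Lemma coef_affine_exp x y n k :
  ((y%:P + x *: 'X) ^+ n)`_k = thinning x y n k.
Proof.
have term i : (y%:P ^+ (n - i) * (x *: 'X) ^+ i *+ 'C(n, i))`_k =
    if k == i then thinning x y n i else 0.
  rewrite coefMn exprZn -polyC_exp coefCM coefZ coefXn /thinning eq_sym.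
  by case: eqP => _; rewrite ?(mulr1, mulr0) ?mul0rn// -mulr_natl; ring.
rewrite exprDn coef_sum; under eq_bigr do rewrite term.
case: (ltnP n k) => [nk|kn].
  rewrite thinning_small// big1// => i _; case: eqP => // ki.
  by have := ltn_ord i; rewrite -ki ltnS leqNgt nk.
rewrite (bigD1 (Ordinal (kn : (k < n.+1)%N)))//= eqxx big1 ?addr0// => i.
move=> ik; case: eqP => // ki; case/eqP: ik; exact: val_inj.
Qed.

(** The affine maps w |-> (w - y) / x and z |-> y + x z are inverse to each
    other; both sides are the coefficient of w^m in w^n. *)
Lemma thinning_inverse x y n m : x != 0 ->
  \sum_(k < n.+1) thinning x y n k * thinning x^-1 (- (y / x)) k m =
  (n == m)%:R.
Proof.
move=> x0; rewrite eq_sym -coefXn.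
have -> : 'X^n =
    (y%:P + x *: ((- (y / x))%:P + x^-1 *: 'X)) ^+ n :> {poly R}.
  congr (_ ^+ n); rewrite scalerDr scalerA divff// scale1r -mul_polyC -polyCM.
  by rewrite mulrN mulrC divfK// polyCN addrA subrr add0r.
rewrite exprDn coef_sum; apply: eq_bigr => k _.
rewrite coefMn exprZn -polyC_exp coefCM coefZ coef_affine_exp.
by rewrite -[RHS]mulr_natl /thinning; ring.
Qed.

End thinning_algebra.

Lemma thinning_ge0 (R : numDomainType) (x y : R) n k :
  0 <= x -> 0 <= y -> 0 <= thinning x y n k.
Proof. by move=> x0 y0; rewrite /thinning !mulr_ge0// ?exprn_ge0. Qed.

Lemma thinning_sign (R : comPzRingType) (x y : R) n k :
  thinning x (- y) n k = (-1) ^+ odd (n - k) * thinning x y n k.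
Proof. by rewrite /thinning (exprNn y) signr_odd mulrCA. Qed.

(** * Thinning of laws on the natural numbers *)

Section series.
Variable R : realType.
Implicit Types (a b : nat -> R) (x y l : R).
Local Open Scope ereal_scope.

Lemma eseries_finite_support (u : nat -> \bar R) n :
  (forall k, 0 <= u k) -> (forall k, (n <= k)%N -> u k = 0) ->
  \sum_(k <oo) u k = \sum_(k < n) u k.
Proof.
move=> u0 un; rewrite (nneseries_split 0%N n)// add0n [X in _ + X]eseries0.
  by rewrite adde0 big_mkord.
by move=> k nk _; exact: un.
Qed.

Lemma eseries_supported_at (u : nat -> \bar R) m :
  (forall k, 0 <= u k) -> (forall k, k != m -> u k = 0) ->
  \sum_(k <oo) u k = u m.
Proof.
move=> u0 um; rewrite (@eseries_finite_support _ m.+1)//; last first.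
  by move=> k mk; rewrite um// gtn_eqF.
rewrite (bigD1 ord_max)//= big1 ?adde0// => i im; apply: um.
by apply: contra im => /eqP im; apply/eqP/val_inj.
Qed.

Lemma eseries_expR x : (0 <= x)%R ->
  \sum_(k <oo) (x ^+ k / k`!%:R)%:E = (expR x)%:E.
Proof.
move=> x0; rewrite /expR -EFin_lim; last exact: is_cvg_series_exp_coeff.
by apply/congr_lim/funext => n /=; rewrite /series/= -sumEFin.
Qed.

(** The terms with n < k vanish, and C(n + k, k) / (n + k)! = 1 / (k! n!) turns
    the others into the exponential series of [l * y]. *)
Lemma poisson_thinning l x y k : (0 < l)%R -> (0 <= x)%R -> (0 <= y)%R ->
  \sum_(n <oo) (poisson_pmf l n * thinning x y n k)%:E =
  ((l * x) ^+ k / k`!%:R * expR (l * (y - 1)))%:E.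
Proof.
move=> l0 x0 y0.
have t0 n : 0 <= (poisson_pmf l n * thinning x y n k)%:E.
  by rewrite lee_fin mulr_ge0// ?poisson_pmf_ge0// thinning_ge0.
rewrite (nneseries_split 0%N k)// add0n big_nat big1 ?add0e; last first.
  by move=> n /= nk; rewrite thinning_small ?mulr0.
rewrite -(nneseries_addn _ t0).
have e n : (poisson_pmf l (n + k) * thinning x y (n + k) k)%:E =
    ((l * x) ^+ k / k`!%:R * expR (- l))%:E * ((l * y) ^+ n / n`!%:R)%:E.
  rewrite -EFinM /poisson_pmf l0 /thinning addnK; congr EFin.
  have := bin_fact (leq_addl n k); rewrite addnK.
  move=> /(congr1 (fun i => i%:R : R)).
  rewrite !natrM => <-.
  have nf i : i`!%:R != 0%R :> R by rewrite pnatr_eq0 -lt0n fact_gt0.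
  have cf : 'C(n + k, k)%:R != 0%R :> R.
    by rewrite pnatr_eq0 -lt0n bin_gt0 leq_addl.
  by rewrite exprD !exprMn; field; rewrite !nf cf.
under eq_eseriesr do rewrite e.
have ly : (0 <= l * y)%R by rewrite mulr_ge0// ltW.
rewrite nneseriesZl; last first.
  by move=> n _; rewrite lee_fin mulr_ge0// ?exprn_ge0// invr_ge0.
rewrite eseries_expR// -EFinM -[(_ * expR (l * y))%R]mulrA -expRD.
by rewrite mulrBr mulr1 addrC.
Qed.

(** The inverse kernel has the sign of the parity of k - m, so its
    composition with the kernel splits as even part minus odd part = [n == m].
    The even and odd parts have nonnegative terms, hence their averages under
    [a] and under [b] are determined by the thinned laws, by interchanging the
    sums; the last hypothesis makes them finite, so that they cancel and leave
    the mass at m. *)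
Lemma thinning_injective a b x y m : (0 < x)%R -> (0 <= y)%R ->
  (forall n, 0 <= a n)%R -> (forall n, 0 <= b n)%R ->
  (forall k, \sum_(n <oo) (a n * thinning x y n k)%:E =
             \sum_(n <oo) (b n * thinning x y n k)%:E) ->
  \sum_(k <oo) ((\sum_(n <oo) (b n * thinning x y n k)%:E) *
                (thinning x^-1 (y / x) k m)%:E) < +oo ->
  a m = b m.
Proof.
move=> x0 y0 a0 b0 ab bfin.
pose D n k := thinning x y n k; pose W k := thinning x^-1 (y / x) k m.
have D0 n k : (0 <= D n k)%R by apply: thinning_ge0 => //; exact: ltW.
have W0 k : (0 <= W k)%R.
  by apply: thinning_ge0; rewrite ?divr_ge0// ?invr_ge0 ltW.
pose E c n := (\sum_(k < n.+1) if odd (k - m) == c then D n k * W k else 0)%R.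
have parity n : E false n = (E true n + (n == m)%:R)%R.
  rewrite -(@thinning_inverse _ x y) ?gt_eqF// /E -big_split/=.
  apply: eq_bigr => k _; rewrite thinning_sign -/(D _ _) -/(W _).
  by case: (odd _) => /=; rewrite ?(expr0, expr1); ring.
have E0 c n : (0 <= E c n)%R.
  by apply: sumr_ge0 => k _; case: ifP => // _; exact: mulr_ge0.
have swap (f : nat -> R) c : (forall n, 0 <= f n)%R ->
    \sum_(n <oo) (f n * E c n)%:E =
    \sum_(k <oo) if odd (k - m) == c
      then (\sum_(n <oo) (f n * D n k)%:E) * (W k)%:E else 0.
  move=> f0; pose F n k : \bar R :=
    if odd (k - m) == c then (f n * D n k * W k)%:E else 0.
  have F0 n k : 0 <= F n k.
    by rewrite /F; case: ifP => // _; rewrite lee_fin mulr_ge0// mulr_ge0.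
  transitivity (\sum_(n <oo) \sum_(k <oo) F n k).
    apply: eq_eseriesr => n _; rewrite (@eseries_finite_support _ n.+1)//.
      rewrite /E mulr_sumr -sumEFin; apply: eq_bigr => k _.
      by rewrite /F; case: ifP; rewrite ?mulr0// mulrA.
    by move=> k nk; rewrite /F /D thinning_small// mulr0 mul0r; case: ifP.
  rewrite nneseries_interchange//; apply: eq_eseriesr => k _; rewrite /F.
  case: ifP => _; last by rewrite eseries0.
  under eq_eseriesr do rewrite EFinM muleC.
  by rewrite nneseriesZl 1?muleC// => n _; rewrite lee_fin mulr_ge0.
have same c : \sum_(n <oo) (a n * E c n)%:E = \sum_(n <oo) (b n * E c n)%:E.
  by rewrite !swap//; apply: eq_eseriesr => k _; rewrite ab.
have split (f : nat -> R) : (forall n, 0 <= f n)%R ->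
    \sum_(n <oo) (f n * E false n)%:E =
    \sum_(n <oo) (f n * E true n)%:E + (f m)%:E.
  move=> f0; under eq_eseriesr do rewrite parity mulrDr EFinD.
  rewrite nneseriesD => [|n _ _|n _ _]; rewrite ?lee_fin ?mulr_ge0//.
  congr (_ + _); rewrite (@eseries_supported_at _ m) ?eqxx ?mulr1//.
    by move=> k; rewrite lee_fin mulr_ge0.
  by move=> k /negbTE ->; rewrite mulr0.
have fin : \sum_(n <oo) (b n * E true n)%:E \is a fin_num.
  rewrite ge0_fin_numE; last first.
    by apply: nneseries_ge0 => n _ _; rewrite lee_fin mulr_ge0.
  have M0 k : 0 <= \sum_(n <oo) (b n * thinning x y n k)%:E.
    by apply: nneseries_ge0 => n _ _; rewrite lee_fin mulr_ge0// D0.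
  apply: le_lt_trans bfin; rewrite swap//.
  apply: lee_nneseries => [k _ _|k _].
    by case: ifP => // _; rewrite mule_ge0 ?M0 ?lee_fin ?W0.
  by case: ifP => // _; rewrite mule_ge0 ?M0 ?lee_fin ?W0.
have cancel (s u v : \bar R) : s \is a fin_num -> s + u = s + v -> u = v.
  move=> sfin suv; rewrite -(addeK u sfin) [u + s]addeC suv.
  by rewrite [s + v]addeC addeK.
apply: EFin_inj; apply: cancel fin _.
by have := same false; rewrite !split// same.
Qed.

End series.

(** * Laws of partial sums and of random sums *)

Section measure_facts.
Context d (T : measurableType d) (R : realType).
Local Open Scope ereal_scope.

Lemma eq_prob_off_null (mu : probability T R) (A B Z : set T) :
  measurable A -> measurable B -> measurable Z -> mu Z = 0 ->
  A `\` Z = B `\` Z -> mu A = mu B.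
Proof.
move=> mA mB mZ Z0 AB; rewrite (measureDI mu mA mZ) (measureDI mu mB mZ) AB.
have null C : measurable C -> mu (C `&` Z) = 0.
  by move=> mC; apply: subset_measure0 Z0 => //; exact: measurableI.
by congr (_ + _); transitivity (0 : \bar R); [exact: null|exact/esym/null].
Qed.

Lemma eq_measure_nat (mu nu : {measure set nat -> \bar R}) :
  (forall n, mu [set n] = nu [set n]) -> mu =1 nu.
Proof.
move=> eq1 A; rewrite -[A]image_id -bigcup_imset1.
have tA : trivIset A (fun n => [set n]) by move=> i j _ _ [x [/= -> ->]].
by rewrite !measure_bigcup//; apply: eq_eseriesr.
Qed.

End measure_facts.

Section sparse_nat.
Variable R : realType.

(** The naturals outside 2, ..., k: a sum of such numbers that is at most k
    has all its terms in {0, 1}. *)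
Definition sparse_nat (k : nat) : set R :=
  [set i%:R | i in [set i : nat | (i <= 1)%N || (k < i)%N]].

Lemma measurable_sparse_nat k : measurable (sparse_nat k).
Proof.
apply: countable_measurable => // .
by apply: sub_countable (@countableP _ _); exact: card_image_le.
Qed.

End sparse_nat.
Arguments sparse_nat R k : clear implicits.

Section partial_sums.
Context d (T : measurableType d) (R : realType) (P : probability T R).
Variable X : nat -> {RV P >-> R}.

Definition partial_sum n w : R := \sum_(i < n) X i w.

Lemma measurable_partial_sum n (B : set R) :
  measurable B -> measurable (partial_sum n @^-1` B).
Proof.
by move=> mB; rewrite -[X in measurable X]setTI; apply: measurable_sum.
Qed.

(** The independence hypothesis on [N] concerns the events of the sigma-algebra
    generated by [X]; the [X i], and hence their sums, are measurable for it. *)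
Lemma partial_sum_sigma_family n (B : set R) :
  measurable B -> sigma_family X (partial_sum n @^-1` B).
Proof.
move=> mB; pose G := \bigcup_i preimage_set_system setT (X i) measurable.
have mX i : measurable_fun [set: g_sigma_algebraType G] (X i).
  move=> _ C mC; apply: sub_sigma_algebra; exists i => //.
  by exists C.
have : measurable_fun [set: g_sigma_algebraType G]
   (fun w => \sum_(i < n) X i w) by apply: measurable_sum.
by move=> /(_ measurableT _ mB); rewrite setTI.
Qed.

Hypothesis X_iid : iid X.
Local Open Scope ereal_scope.

Lemma iid_prob i (B : set R) : measurable B ->
  P (X i @^-1` B) = P (X 0%N @^-1` B).
Proof. by case: X_iid => _ /(_ i 0%N B). Qed.

Lemma independent_cylinder M (A : nat -> set R) :
  (forall i, measurable (A i)) ->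
  P (\big[setI/setT]_(0 <= i < M) (X i @^-1` A i)) =
  \prod_(0 <= i < M) P (X i @^-1` A i).
Proof.
move=> mA; have [indep _] := X_iid.
have perm : perm_eq (seq_fset tt (index_iota 0 M)) (index_iota 0 M).
  by rewrite -[X in perm_eq _ X]undup_id ?iota_uniq//; exact: seq_fset_perm.
have := indep (seq_fset tt (index_iota 0 M)) A mA.
by rewrite bigcap_seq !(perm_big _ perm).
Qed.

Variables (k : nat) (x0 x1 : R).
Hypothesis sparse : P (X 0%N @^-1` (~` sparse_nat R k)) = 0.
Hypothesis x0E : P (X 0%N @^-1` [set 0%R]) = x0%:E.
Hypothesis x1E : P (X 0%N @^-1` [set 1%R]) = x1%:E.

(* Off the null set [Z] every [X i] takes its values in [sparse_nat]. *)
Let Z := \bigcup_i (X i @^-1` (~` sparse_nat R k)).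

Let mXinv i (B : set R) : measurable B -> measurable (X i @^-1` B).
Proof. by move=> mB; exact: measurable_funPTI. Qed.

Let mZ : measurable Z.
Proof.
apply: bigcupT_measurable => i; apply: mXinv; apply: measurableC.
exact: measurable_sparse_nat.
Qed.

Let Z0 : P Z = 0.
Proof.
have mS : measurable (~` sparse_nat R k).
  by apply: measurableC; exact: measurable_sparse_nat.
apply/(negligibleP P mZ)/negligible_bigcup => i.
by apply/(negligibleP P (mXinv i mS)); exact: etrans (iid_prob i mS) sparse.
Qed.

Let sparse_off_null w i : ~ Z w -> sparse_nat R k (X i w).
Proof. by move=> nZ; apply: contrapT => nB; apply: nZ; exists i. Qed.

Let partial_sum_nat n w : ~ Z w -> exists m : nat, partial_sum n w = m%:R.
Proof.
move=> nZ; elim: n => [|n [m IH]].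
  by exists 0%N; rewrite /partial_sum big_ord0.
rewrite /partial_sum big_ord_recr/= -/(partial_sum n w) IH.
by have [i _ <-] := sparse_off_null n nZ; exists (m + i)%N; rewrite natrD.
Qed.

Let partial_sumS0 n w : ~ Z w ->
  partial_sum n.+1 w = 0%:R <-> partial_sum n w = 0%:R /\ X n w = 0%:R.
Proof.
move=> nZ; rewrite /partial_sum big_ord_recr/= -/(partial_sum n w).
have [m ->] := partial_sum_nat n nZ; have [i _ <-] := sparse_off_null n nZ.
rewrite -natrD; split => [/eqP|[/eqP + /eqP]]; rewrite !eqr_nat.
  by rewrite addn_eq0 => /andP[/eqP -> /eqP ->].
by move=> /eqP -> /eqP ->.
Qed.

Let partial_sumSS n j w : ~ Z w -> (j < k)%N ->
  partial_sum n.+1 w = j.+1%:R <->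
  (partial_sum n w = j.+1%:R /\ X n w = 0%:R) \/
  (partial_sum n w = j%:R /\ X n w = 1%:R).
Proof.
move=> nZ jk; rewrite /partial_sum big_ord_recr/= -/(partial_sum n w).
have [m ->] := partial_sum_nat n nZ; have [i /= ik <-] := sparse_off_null n nZ.
have natE a b : ((a%:R : R) = b%:R) <-> a = b.
  by split=> [/eqP|->//]; rewrite eqr_nat => /eqP.
rewrite -natrD !natE; split => [mi|[[-> ->]|[-> ->]]]; rewrite ?addn0 ?addn1//.
have i1 : (i <= 1)%N.
  case/orP: ik => // ki; have : (i <= j.+1)%N by rewrite -mi leq_addl.
  by move=> /(leq_trans ki); rewrite ltnS leqNgt jk.
move: i i1 mi {ik} => [|[|//]] _; rewrite ?addn0 ?addn1; first by left.
by move=> [->]; right.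
Qed.

(** Independence is only given as a product rule for cylinders, so the induction
    on n carries along a cylinder over the variables of index at least n.
    Conditioning on [X n = 0] or [X n = 1] adds one factor to that cylinder and
    reproduces Pascal's rule [thinningSS]. *)
Lemma partial_sum_cylinder n j M (A : nat -> set R) :
  (n <= M)%N -> (j <= k)%N -> (forall i, measurable (A i)) ->
  P (partial_sum n @^-1` [set j%:R] `&`
     \big[setI/setT]_(n <= i < M) (X i @^-1` A i)) =
  (thinning x1 x0 n j)%:E * \prod_(n <= i < M) P (X i @^-1` A i).
Proof.
elim: n j A => [|n IH] j A nM jk mA.
  have -> : partial_sum 0 @^-1` [set j%:R] = if j == 0%N then setT else set0.
    apply/seteqP; split => w; rewrite /= /partial_sum big_ord0;
      case: j {jk} => //=.
    by move=> j /eqP; rewrite eq_sym pnatr_eq0.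
  case: j jk => [|j] _ /=.
    by rewrite setTI independent_cylinder// /thinning bin0 !expr0 !mul1r mul1e.
  by rewrite set0I measure0 /thinning bin0n !mul0r mul0e.
set E := \big[setI/setT]_(_ <= i < _) _; set p := \prod_(_ <= i < _) _.
have mE : measurable E by apply: bigsetI_measurable => i _; exact: mXinv.
have mps i m : measurable (partial_sum i @^-1` [set m%:R]).
  exact: measurable_partial_sum.
(* fixing the value of X n turns it into one more factor of the cylinder *)
have peel m (c : R) : (m <= k)%N ->
    P (partial_sum n @^-1` [set m%:R] `&` X n @^-1` [set c] `&` E) =
    (thinning x1 x0 n m)%:E * P (X 0%N @^-1` [set c]) * p.
  move=> mk; pose A' i := if i == n then [set c] else A i.
  have mA' i : measurable (A' i) by rewrite /A'; case: ifP.
  have A'n : A' n = [set c] by rewrite /A' eqxx.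
  have A'E i : (n < i)%N -> A' i = A i by move=> ni; rewrite /A' gtn_eqF.
  have := IH m A' (ltnW nM) mk mA'; rewrite !(big_ltn nM) A'n.
  rewrite iid_prob// setIA muleA.
  have -> : \big[setI/setT]_(n.+1 <= i < M) (X i @^-1` A' i) = E.
    by apply: eq_big_nat => i /andP[ni _]; rewrite A'E.
  suff -> : \prod_(n.+1 <= i < M) P (X i @^-1` A' i) = p by [].
  by apply: eq_big_nat => i /andP[ni _]; rewrite A'E.
have mevent m c : measurable
    (partial_sum n @^-1` [set m%:R] `&` X n @^-1` [set c] `&` E).
  by apply: measurableI mE; apply: measurableI; [exact: mps|exact: mXinv].
case: j jk => [|j] jk.
  rewrite (eq_prob_off_null (measurableI _ _ (mps _ _) mE)
    (mevent 0%N 0%:R) mZ Z0).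
    by rewrite peel// x0E -EFinM thinningS0.
  apply/seteqP; split => w [].
    by move=> [/= /[swap] Ew S0] nZ; split => //; case/(partial_sumS0 n nZ): S0.
  by move=> [/= + Ew] nZ; split => //; split=> //; apply/(partial_sumS0 n nZ).
rewrite (eq_prob_off_null (measurableI _ _ (mps _ _) mE)
   (measurableU _ _ (mevent j.+1 0%:R) (mevent j 1%:R)) mZ Z0).
  have PU A1 A2 : measurable A1 -> measurable A2 -> A1 `&` A2 = set0 ->
      P (A1 `|` A2) = P A1 + P A2 by exact: measureU.
  rewrite (PU _ _ (mevent _ _) (mevent _ _)); last first.
    apply/seteqP; split => w //= [[[_ X0] _] [[_ X1] _]].
    by move: X1; rewrite X0 => /eqP; rewrite eqr_nat.
  rewrite !peel ?(ltnW jk)// x0E x1E -!EFinM.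
  have x0_ge0 : (0 <= x0)%R by rewrite -lee_fin -x0E.
  have x1_ge0 : (0 <= x1)%R by rewrite -lee_fin -x1E.
  have t_ge0 m c : (0 <= c)%R -> 0 <= (thinning x1 x0 n m * c)%:E.
    by move=> c0; rewrite lee_fin; exact/mulr_ge0/c0/thinning_ge0.
  rewrite -(ge0_muleDl _ (t_ge0 _ _ x0_ge0) (t_ge0 _ _ x1_ge0)).
  by rewrite -EFinD thinningSS.
apply/seteqP; split => w [].
  move=> [/= S1 Ew] nZ; split => //.
  by case/(partial_sumSS n nZ jk): S1 => -[? ?]; [left|right].
by move=> [[[/= ? ?] Ew]|[[/= ? ?] Ew]] nZ; split => //; split=> //;
  apply/(partial_sumSS n nZ jk); [left|right].
Qed.

Lemma partial_sum_law n :
  P (partial_sum n @^-1` [set k%:R]) = (thinning x1 x0 n k)%:E.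
Proof.
have := @partial_sum_cylinder n k n (fun=> setT)
  (leqnn n) (leqnn k) (fun=> measurableT).
by rewrite !big_geq// setIT mule1.
Qed.

End partial_sums.

Section random_sums.
Context d (T : measurableType d) (R : realType) (P : probability T R).
Variables (N : {RV P >-> nat}) (X : nat -> {RV P >-> R}).
Hypothesis N_indep : independent_of_family N X.
Local Open Scope ereal_scope.

Lemma random_sum_event n (B : set R) : measurable B ->
  P (N @^-1` [set n] `&` random_sum N X @^-1` B) =
  P (N @^-1` [set n]) * P (partial_sum X n @^-1` B).
Proof.
move=> mB; rewrite -N_indep//; last exact: partial_sum_sigma_family.
congr (P _); apply/seteqP; rewrite /random_sum/partial_sum.
by split => w /= [Nw]; rewrite Nw.
Qed.

Lemma random_sum_law (B : set R) : measurable B ->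
  P (random_sum N X @^-1` B) =
  \sum_(n <oo) P (N @^-1` [set n]) * P (partial_sum X n @^-1` B).
Proof.
move=> mB.
have mS : measurable (random_sum N X @^-1` B).
  by rewrite -[X in measurable X]setTI; exact: measurable_random_sum.
have -> : random_sum N X @^-1` B =
    \bigcup_n (N @^-1` [set n] `&` random_sum N X @^-1` B).
  apply/seteqP; split => w; first by exists (N w).
  by case=> n _ [].
rewrite measure_semi_bigcup.
- by apply: eq_eseriesr => n _; exact: random_sum_event.
- by move=> n; apply: measurableI mS; exact: measurable_funPTI.
- by move=> i j _ _ [w [[/= <- _] [/= <- _]]].
- apply: bigcupT_measurable => n; apply: measurableI mS.
  exact: measurable_funPTI.
Qed.

End random_sums.

(** * Poisson and Bernoulli laws *)

Section named_laws.
Context (R : realType).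
Local Open Scope ereal_scope.

Lemma poisson_nat1 (l : R) k : (0 < l)%R ->
  poisson_nat l [set k] = (poisson_pmf l k)%:E.
Proof.
move=> l0; rewrite /poisson_nat /poisson_prob l0 esum_set1//.
by rewrite lee_fin poisson_pmf_ge0.
Qed.

Lemma poisson_real1 (l : R) k : (0 < l)%R ->
  poisson_real l [set k%:R] = (poisson_pmf l k)%:E.
Proof.
move=> l0; rewrite -poisson_nat1// /poisson_real /pushforward; congr poisson_nat.
by apply/seteqP; split => i /= => [/eqP|->//]; rewrite eqr_nat => /eqP.
Qed.

Lemma bernoulli_realE (p : R) (A : set R) : (0 <= p <= 1)%R ->
  bernoulli_real p A = p%:E * \d_(1%R : R) A + (1 - p)%:E * \d_(0%R : R) A.
Proof. by move=> p01; rewrite /bernoulli_real /pushforward bernoulli_probE. Qed.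

End named_laws.

Section laws_of_variables.
Context d (T : measurableType d) (R : realType) (P : probability T R).
Local Open Scope ereal_scope.

Lemma has_law_prob d' (T' : measurableType d') (Y : {RV P >-> T'})
    (mu : set T' -> \bar R) (B : set T') :
  has_law Y mu -> measurable B -> P (Y @^-1` B) = mu B.
Proof. by move=> law mB; rewrite -law. Qed.

Lemma bernoulli_from_atoms (Y : {RV P >-> R}) (p : R) : (0 <= p <= 1)%R ->
  P (Y @^-1` [set 0%R]) = (1 - p)%:E -> P (Y @^-1` [set 1%R]) = p%:E ->
  has_law Y (bernoulli_real p).
Proof.
move=> p01 Y0 Y1 A mA; rewrite bernoulli_realE// /distribution /pushforward.
have mY (B : set R) : measurable B -> measurable (Y @^-1` B).
  by move=> mB; exact: measurable_funPTI.
have PU B C : measurable B -> measurable C -> B `&` C = set0 ->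
    P (B `|` C) = P B + P C by exact: measureU.
have disj (B C : set R) :
    Y @^-1` (B `&` [set 1%R]) `&` Y @^-1` (C `&` [set 0%R]) = set0.
  apply/seteqP; split => w //= [[_ ->] [_ /eqP]].
  by rewrite oner_eq0.
have atom c : P (Y @^-1` (A `&` [set c])) = P (Y @^-1` [set c]) * \d_c A.
  rewrite diracE; have [cA|cA] := boolP (c \in A).
    rewrite mule1; congr (P (_ @^-1` _)); apply/setIidr => _ ->.
    by move: cA; rewrite inE.
  rewrite mule0 (_ : _ `&` _ = set0) ?preimage_set0 ?measure0//.
  by apply/seteqP; split=> // t [/= At tc]; move: cA; rewrite -tc mem_set.
(* [Y] lies almost surely in {0, 1}; cut each event along these two atoms *)
pose U B := Y @^-1` (B `&` [set 1%R]) `|` Y @^-1` (B `&` [set 0%R]).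
have PUE B : measurable B ->
    P (U B) = P (Y @^-1` (B `&` [set 1%R])) + P (Y @^-1` (B `&` [set 0%R])).
  move=> mB; apply: PU; [| |exact: disj];
  by apply: mY; apply: measurableI => //; exact: measurable_set1.
have mU B : measurable B -> measurable (U B).
  by move=> mB; apply: measurableU;
    apply: mY; apply: measurableI => //; exact: measurable_set1.
have null : P (~` U setT) = 0.
  rewrite probability_setC ?PUE; [|exact: measurableT|exact: mU].
  have pq : (p + (1 - p) = 1)%R by ring.
  by rewrite !setTI Y0 Y1 -EFinD pq subrr.
rewrite (eq_prob_off_null (mY _ mA) (mU _ mA)
  (measurableC (mU _ measurableT)) null).
  by rewrite PUE// !atom Y0 Y1.
apply/seteqP; split => w [].
  move=> Aw nn; split => //; move: nn => /contrapT[[_ Yw]|[_ Yw]].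
    by left.
  by right.
by move=> [[Aw _]|[Aw _]] nn.
Qed.

End laws_of_variables.

(** * Random sums with a Poisson law *)

Section compound_poisson.
Context d (T : measurableType d) (R : realType) (P : probability T R).
Variables (N : {RV P >-> nat}) (X : nat -> {RV P >-> R}).
Hypothesis (X_iid : iid X) (N_indep : independent_of_family N X).
Local Open Scope ereal_scope.

Lemma random_sum_thinning k (x0 x1 mu : R) :
  P (X 0%N @^-1` (~` sparse_nat R k)) = 0 ->
  P (X 0%N @^-1` [set 0%R]) = x0%:E -> P (X 0%N @^-1` [set 1%R]) = x1%:E ->
  (0 < mu)%R -> has_law (random_sum N X : {RV P >-> R}) (poisson_real mu) ->
  \sum_(n <oo) (fine (P (N @^-1` [set n])) * thinning x1 x0 n k)%:E =
  (poisson_pmf mu k)%:E.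
Proof.
move=> sparse x0E x1E mu0 S_law.
have mk : measurable [set k%:R : R] by exact: measurable_set1.
rewrite -poisson_real1// -(has_law_prob S_law mk) random_sum_law//.
apply: eq_eseriesr => n _; rewrite (partial_sum_law X_iid sparse x0E x1E).
by rewrite EFinM fineK// fin_num_measure//; exact: measurable_funPTI.
Qed.

Variables (mu : R).
Hypotheses (mu0 : (0 < mu)%R)
  (S_law : has_law (random_sum N X : {RV P >-> R}) (poisson_real mu)).

(** The law of [N] and Poisson(mu / p) have the same thinning, Poisson(mu). *)
Lemma poisson_of_bernoulli_sum (p : R) :
  (0 < p < 1)%R -> has_law (X 0%N) (bernoulli_real p) ->
  has_law N (poisson_nat (mu / p)).
Proof.
move=> /andP[p0 p1] X_law; have l0 : (0 < mu / p)%R by rewrite divr_gt0.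
have q0 : (0 <= 1 - p)%R by rewrite subr_ge0 ltW.
have p01 : (0 <= p <= 1)%R by rewrite !ltW.
have X0E : P (X 0%N @^-1` [set 0%R]) = (1 - p)%:E.
  rewrite (has_law_prob X_law)// bernoulli_realE// !diracE.
  by rewrite memNset ?mem_set//= ?mule0 ?add0e ?mule1//; apply/eqP/oner_neq0.
have X1E : P (X 0%N @^-1` [set 1%R]) = p%:E.
  rewrite (has_law_prob X_law)// bernoulli_realE// !diracE.
  rewrite mem_set// memNset ?mule0 ?adde0 ?mule1//=.
  by apply/eqP; rewrite eq_sym oner_neq0.
have sparse k : P (X 0%N @^-1` (~` sparse_nat R k)) = 0.
  rewrite (has_law_prob X_law); last first.
    by apply: measurableC; exact: measurable_sparse_nat.
  have nat01 (b : bool) : (b%:R : R) \in ~` sparse_nat R k = false.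
    by apply: memNset; apply; exists (nat_of_bool b) => //=; case: b.
  by rewrite bernoulli_realE// !diracE (nat01 true) (nat01 false) !mule0 adde0.
have NE n : P (N @^-1` [set n]) = (fine (P (N @^-1` [set n])))%:E.
  by rewrite fineK// fin_num_measure//; exact: measurable_funPTI.
have moment k :
    \sum_(n <oo) (poisson_pmf (mu / p) n * thinning p (1 - p) n k)%:E =
    (poisson_pmf mu k)%:E.
  rewrite poisson_thinning// ?ltW// divfK ?gt_eqF// /poisson_pmf mu0.
  by congr (_ * expR _)%:E; field; rewrite gt_eqF.
have N_pmf m : P (N @^-1` [set m]) = (poisson_pmf (mu / p) m)%:E.
  rewrite NE; congr EFin.
  pose a n := fine (P (N @^-1` [set n])).
  apply: (@thinning_injective _ a (poisson_pmf (mu / p)) p (1 - p)) => //.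
  - by move=> n; exact: fine_ge0.
  - by move=> n; exact: poisson_pmf_ge0.
  - by move=> k; rewrite moment; exact: random_sum_thinning.
  under eq_eseriesr do rewrite moment -EFinM.
  by rewrite poisson_thinning ?ltry// ?divr_ge0// ?invr_ge0 ltW.
move=> A _; rewrite /distribution /pushforward.
apply: (@eq_measure_nat R (distribution P N) (poisson_prob (mu / p) 0%N)) => n.
by rewrite [RHS]poisson_nat1// -N_pmf.
Qed.

(** The values of P(S = k) for k = 0, 1 determine both masses [x0] and [x1], and
    these turn out to exhaust the law of [X 0]. *)
Lemma bernoulli_of_poisson_count (l : R) :
  (0 < l)%R -> has_law N (poisson_nat l) ->
  (0 < mu / l <= 1)%R /\ has_law (X 0%N) (bernoulli_real (mu / l)).
Proof.
move=> l0 N_law.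
have N_pmf n : P (N @^-1` [set n]) = (poisson_pmf l n)%:E.
  by rewrite (has_law_prob N_law)// poisson_nat1.
have pmf_gt0 n : (0 < poisson_pmf l n)%R.
  by rewrite /poisson_pmf l0 !mulr_gt0 ?expR_gt0 ?exprn_gt0 ?invr_gt0
    ?ltr0n ?fact_gt0.
have mXinv (B : set R) : measurable B -> measurable (X 0%N @^-1` B).
  by move=> mB; exact: measurable_funPTI.
have sparse k : (k <= 1)%N -> P (X 0%N @^-1` (~` sparse_nat R k)) = 0.
  move=> k1.
  have mC : measurable (~` sparse_nat R k).
    by apply: measurableC; exact: measurable_sparse_nat.
  (* on the event N = 1 the sum is X 0 *)
  have : P (N @^-1` [set 1%N]) * P (X 0%N @^-1` (~` sparse_nat R k)) = 0.
    have -> : X 0%N @^-1` (~` sparse_nat R k) =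
        partial_sum X 1 @^-1` (~` sparse_nat R k).
      by apply/seteqP; rewrite /partial_sum; split => w /=; rewrite big_ord1.
    rewrite -(random_sum_event N_indep)//; apply/eqP; rewrite -measure_le0.
    have <- : P (random_sum N X @^-1` (~` sparse_nat R k)) = 0.
      rewrite (has_law_prob S_law)// /poisson_real /pushforward.
      rewrite [X in poisson_nat _ X](_ : _ = set0) ?measure0//.
      apply/seteqP; split => // i /=; apply; exists i => //=.
      by case: (ltnP k i) => [_|ik]; rewrite ?orbT// (leq_trans ik).
    have mS : measurable (random_sum N X @^-1` (~` sparse_nat R k)).
      by rewrite -[X in measurable X]setTI; exact: measurable_random_sum.
    apply: le_measure => [| |w []//]; rewrite inE//.
    by apply: measurableI => //; exact: measurable_funPTI.
  by move/eqP; rewrite mule_eq0 N_pmf eqe gt_eqF//= => /eqP.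
pose x0 := fine (P (X 0%N @^-1` [set 0%R])).
pose x1 := fine (P (X 0%N @^-1` [set 1%R])).
have X0E : P (X 0%N @^-1` [set 0%R]) = x0%:E.
  by rewrite fineK// fin_num_measure//; exact: mXinv.
have X1E : P (X 0%N @^-1` [set 1%R]) = x1%:E.
  by rewrite fineK// fin_num_measure//; exact: mXinv.
have x0_ge0 : (0 <= x0)%R by exact: fine_ge0.
have x1_ge0 : (0 <= x1)%R by exact: fine_ge0.
(* P(S = k), computed from the laws of [N] and [X 0] and from that of [S] *)
have sum_pmf k : (k <= 1)%N ->
    ((l * x1) ^+ k / k`!%:R * expR (l * (x0 - 1)) =
     mu ^+ k / k`!%:R * expR (- mu))%R.
  move=> k1; apply: EFin_inj; rewrite -poisson_thinning//.
  have := random_sum_thinning (sparse k k1) X0E X1E mu0 S_law.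
  by rewrite /poisson_pmf mu0 => <-; apply: eq_eseriesr => n _; rewrite N_pmf.
have exp0 : expR (l * (x0 - 1)) = expR (- mu).
  by have := sum_pmf 0%N isT; rewrite !expr0 !divr1 !mul1r.
have lx1 : (l * x1)%R = mu.
  have := sum_pmf 1%N isT; rewrite !expr1 !divr1 exp0.
  by apply: mulIf; rewrite gt_eqF ?expR_gt0.
have lx0 : (l * (x0 - 1))%R = (- mu)%R by exact: expR_inj.
have x1E : x1 = (mu / l)%R by rewrite -lx1 mulrAC divff ?mul1r// gt_eqF.
have x0E : x0 = (1 - x1)%R.
  apply: (mulfI (lt0r_neq0 l0)); rewrite mulrBr mulr1 lx1.
  by rewrite -[mu]opprK -lx0; ring.
have p01 : (0 < mu / l <= 1)%R.
  by rewrite divr_gt0//= -x1E -subr_ge0 -x0E.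
split=> //; apply: bernoulli_from_atoms; rewrite -x1E -?x0E//.
by rewrite x1E; case/andP: p01 => /ltW -> ->.
Qed.

End compound_poisson.

(* In part (b) the value p = 1 cannot be excluded: if every X i is the
   constant 1 then random_sum N X = N. *)
Theorem proposition4p2 (R : realType) (d : measure_display)
    (T : measurableType d) (P : probability T R)
    (N : {RV P >-> nat}) (X : nat -> {RV P >-> R})
    (N_neq0 : (P (N @^-1` [set 0%N]) < 1)%E)
    (X_iid : iid X)
    (N_indep : independent_of_family N X)
    (S_poisson : exists2 mu : R, 0 < mu &
       has_law (random_sum N X : {RV P >-> R}) (poisson_real mu)) :
  ((exists2 p : R, 0 < p < 1 & has_law (X 0%N) (bernoulli_real p)) ->
   exists2 l : R, 0 < l & has_law N (poisson_nat l))
  /\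
  ((exists2 l : R, 0 < l & has_law N (poisson_nat l)) ->
   exists2 p : R, 0 < p <= 1 & has_law (X 0%N) (bernoulli_real p)).
Proof.
have [mu mu0 S_law] := S_poisson; split => [[p p01 X_law]|[l l0 N_law]].
  exists (mu / p); first by case/andP: p01 => p0 _; exact: divr_gt0.
  exact: (poisson_of_bernoulli_sum X_iid N_indep mu0 S_law p01 X_law).
have [p01 X_law] := bernoulli_of_poisson_count X_iid N_indep mu0 S_law l0 N_law.
by exists (mu / l).
Qed.
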